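(* Let $A\in\mathbb{C}^{N\times N}$, $b\in\mathbb{C}^N$, and let $$A B_m = B_m H_m + b_{m+1}h_{m+1,m}e_m^{\top}$$ be an Arnoldi-like decomposition with $b=b_1\beta$, where $b_1$ is the first column of $B_m$ and $\beta\in\mathbb{C}$. Suppose that $f$ admits the integral representation $f(z)=\int_\Gamma \frac{g(t)}{t-z}\,dt$ for $z\in\Omega$, and let $\widetilde f_m := B_m f(H_m)e_1\beta$ be the Arnoldi-like approximation to $f(A)b$. Define $\phi_m(t)=(t-\theta_1)\cdots(t-\theta_m)$, where $\Lambda(H_m)=\{\theta_1,\dots,\theta_m\}\subset\Omega$ (eigenvalues counted with algebraic multiplicity), and let $\gamma_m=\prod_{j=1}^m h_{j+1,j}$. Then $$f(A)b-\widetilde f_m=\gamma_m\beta\left(\int_\Gamma \frac{g(t)}{\phi_m(t)}(tI-A)^{-1}\,dt\right)b_{m+1},$$ provided that the integral exists. Thus $f(A)b-\widetilde f_m=\mathrm{err}(A)b_{m+1}$ with the error function $$\mathrm{err}(z)=\gamma_m\beta\int_\Gamma\frac{g(t)}{\phi_m(t)}(t-z)^{-1}\,dt.$$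
   Context: Standing setting. The function $f$ is analytic on the closure of a domain $\Omega\subset\mathbb{C}$ that contains the spectrum $\Lambda(A)$; $\Gamma\subset\mathbb{C}\setminus\Omega$ is a contour and $g$ is a suitable function on $\Gamma$ with $f(z)=\int_\Gamma\frac{g(t)}{t-z}\,dt$ for $z\in\Omega$, so that $f(A)b=\int_\Gamma g(t)(tI-A)^{-1}b\,dt$. The Krylov subspace is $\mathcal{K}_m(A,b)=\mathrm{span}\{b,Ab,\dots,A^{m-1}b\}$, and it is assumed that $\dim\mathcal{K}_j(A,b)=j$ for $1\le j\le m$. An Arnoldi-like decomposition is a relation $AB_m=B_mH_m+b_{m+1}h_{m+1,m}e_m^\top$ in which the columns $b_1,\dots,b_m$ of $B_m\in\mathbb{C}^{N\times m}$ form a basis (not necessarily orthonormal) of $\mathcal{K}_m(A,b)$, $H_m=(h_{i,j})\in\mathbb{C}^{m\times m}$ is upper Hessenberg, $b_{m+1}\in\mathbb{C}^N$, $h_{m+1,m}\in\mathbb{C}$, and $b=b_1\beta$ for some $\beta\in\mathbb{C}$. Here $e_i$ denotes the $i$-th unit coordinate vector of $\mathbb{C}^m$. *)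

(* Defs.v *)
From HB Require Import structures.
From mathcomp Require Import all_boot all_order all_algebra.
From mathcomp Require Import all_classical all_reals all_analysis.
From mathcomp Require Import complex.

Set Implicit Arguments.
Unset Strict Implicit.
Unset Printing Implicit Defensive.

Import Order.TTheory GRing.Theory Num.Theory.
Import numFieldNormedType.Exports.

Local Open Scope classical_set_scope.
Local Open Scope ring_scope.
Local Open Scope complex_scope.

(* The complex numbers R[i], viewed as a [numClosedFieldType]: this is the structure
   on which the library puts the topology and the normed space structure (over
   itself) induced by the modulus. *)
Definition Cx (R : realType) : numClosedFieldType := R[i].

(* The field of scalars is [Cx R], so [derivable] and, below, [derive1n] are complex
   differentiability and complex derivatives. *)
Definition analytic_on (R : realType) (f : Cx R -> Cx R) (S : set (Cx R)) : Prop :=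
  forall z, S z -> \forall w \near z, derivable f w 1.

Definition domain (R : realType) (Omega : set (Cx R)) : Prop :=
  [/\ Omega !=set0, open Omega & connected Omega].

(* The parameter interval may be unbounded or lack end points, so that infinite
   contours such as a half-line are allowed. *)
Record arc (R : realType) := Arc {
  arc_dom : interval R;
  arc_fun : R -> Cx R }.

Definition arc_deriv (R : realType) (a : arc R) (s : R) : Cx R :=
  (derive1 (fun u => complex.Re (arc_fun a u)) s)
    +i* (derive1 (fun u => complex.Im (arc_fun a u)) s).

Definition smooth_arc (R : realType) (a : arc R) : Prop :=
  {within [set` arc_dom a], continuous (arc_fun a)} /\
  forall s, ([set` arc_dom a]°) s ->
    [/\ derivable (fun u => complex.Re (arc_fun a u)) s 1,
        derivable (fun u => complex.Im (arc_fun a u)) s 1 &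
        {for s, continuous (arc_deriv a)}].

(* A contour is a finite family of C^1 arcs.  A piecewise C^1 curve is cut at its
   break points; several components (boundary of a multiply connected domain) are
   allowed as well. *)
Record contour (R : realType) := Contour {
  narcs : nat;
  arcs : 'I_narcs -> arc R;
  arcs_smooth : forall k, smooth_arc (arcs k) }.
Arguments arcs [R] c k : rename.

Definition contour_support (R : realType) (Gamma : contour R) : set (Cx R) :=
  [set t | exists k s,
     s \in arc_dom (arcs Gamma k) /\ t = arc_fun (arcs Gamma k) s].

Definition arc_integrand (R : realType) (a : arc R) (h : Cx R -> Cx R)
  (s : R) : Cx R := h (arc_fun a s) * arc_deriv a s.

Definition contour_integrable (R : realType) (Gamma : contour R)
    (h : Cx R -> Cx R) : Prop :=
  forall k,
    (@lebesgue_measure R).-integrable [set` arc_dom (arcs Gamma k)]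
       (fun s => (complex.Re (arc_integrand (arcs Gamma k) h s))%:E) /\
    (@lebesgue_measure R).-integrable [set` arc_dom (arcs Gamma k)]
       (fun s => (complex.Im (arc_integrand (arcs Gamma k) h s))%:E).

Definition contour_integral (R : realType) (Gamma : contour R)
    (h : Cx R -> Cx R) : Cx R :=
  \sum_(k < narcs Gamma)
    ((\int[@lebesgue_measure R]_(s in [set` arc_dom (arcs Gamma k)])
        complex.Re (arc_integrand (arcs Gamma k) h s))
     +i* (\int[@lebesgue_measure R]_(s in [set` arc_dom (arcs Gamma k)])
        complex.Im (arc_integrand (arcs Gamma k) h s))).

Definition contour_integrable_mx (R : realType) (Gamma : contour R) (p q : nat)
    (F : Cx R -> 'M[Cx R]_(p, q)) : Prop :=
  forall i j, contour_integrable Gamma (fun t => F t i j).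

Definition contour_integral_mx (R : realType) (Gamma : contour R) (p q : nat)
    (F : Cx R -> 'M[Cx R]_(p, q)) : 'M[Cx R]_(p, q) :=
  \matrix_(i, j) contour_integral Gamma (fun t => F t i j).

Definition spectrum (R : realType) (n : nat) (M : 'M[Cx R]_n.+1) : set (Cx R) :=
  [set z | eigenvalue M z].

(* [mup z (mxminpoly M)] is the index of the eigenvalue [z] of [M] (size of its
   largest Jordan block), and [0] when [z] is not an eigenvalue. *)
Definition hermite_interpolates (R : realType) (n : nat) (f : Cx R -> Cx R)
    (M : 'M[Cx R]_n.+1) (p : {poly Cx R}) : Prop :=
  forall (z : Cx R) (k : nat), (k < mup z (mxminpoly M))%N ->
    (derivn k p).[z] = derive1n k f z.

(* f(M) = p(M) for any polynomial p interpolating f on the spectrum of M in the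
   Hermite sense.  Such a p always exists and p(M) does not depend on its choice. *)
Definition matfun (R : realType) (n : nat) (f : Cx R -> Cx R)
    (M : 'M[Cx R]_n.+1) : 'M[Cx R]_n.+1 :=
  horner_mx M (xget 0 [set p | hermite_interpolates f M p]).

Definition krylov (R : realType) (n : nat) (A : 'M[Cx R]_n.+1)
    (b : 'cV[Cx R]_n.+1) (j : nat) : {vspace 'cV[Cx R]_n.+1} :=
  <<[seq A ^+ k *m b | k <- iota 0 j]>>%VS.

(* With N = n.+1 and m.+1 basis vectors, indices start at [0]: b_1 is [col ord0 B], and
   the row vector [delta_mx ord0 ord_max] is the transpose of the last unit vector. *)
Definition arnoldi_like (R : realType) (n m : nat) (A : 'M[Cx R]_n.+1)
    (b : 'cV[Cx R]_n.+1) (B : 'M[Cx R]_(n.+1, m.+1)) (H : 'M[Cx R]_m.+1)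
    (bnext : 'cV[Cx R]_n.+1) (hnext beta : Cx R) : Prop :=
  [/\ A *m B = B *m H + (hnext *: bnext) *m delta_mx ord0 ord_max,
      basis_of (krylov A b m.+1) [seq col i B | i : 'I_m.+1],
      (forall i j : 'I_m.+1, (j.+1 < i)%N -> H i j = 0) &
      b = beta *: col ord0 B].

Definition arnoldi_approx (R : realType) (n m : nat) (f : Cx R -> Cx R)
    (B : 'M[Cx R]_(n.+1, m.+1)) (H : 'M[Cx R]_m.+1) (beta : Cx R) :
    'cV[Cx R]_n.+1 :=
  beta *: (B *m matfun f H *m delta_mx ord0 ord0).

(* The subdiagonal entries of [H] times [hnext], the entry below the last diagonal
   entry in the extended Hessenberg matrix. *)
Definition subdiag_prod (R : realType) (m : nat) (H : 'M[Cx R]_m.+1)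
    (hnext : Cx R) : Cx R :=
  (\prod_(j < m) H (inord j.+1) (inord j)) * hnext.

Definition nodal (R : realType) (m : nat) (theta : 'I_m -> Cx R) (t : Cx R) :
    Cx R := \prod_(j < m) (t - theta j).

Definition err_fun (R : realType) (m : nat) (Gamma : contour R)
    (g : Cx R -> Cx R) (H : 'M[Cx R]_m.+1) (hnext beta : Cx R)
    (theta : 'I_m.+1 -> Cx R) (z : Cx R) : Cx R :=
  subdiag_prod H hnext * beta *
    contour_integral Gamma (fun t => g t / nodal theta t * (t - z)^-1).

(* Main.v *)
Require Import Defs.
From HB Require Import structures.
From mathcomp Require Import all_boot all_order all_algebra.
From mathcomp Require Import all_classical all_reals all_analysis.
From mathcomp Require Import measurable_realfun complex.
From mathcomp Require Import ring.

Set Implicit Arguments.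
Unset Strict Implicit.
Unset Printing Implicit Defensive.

Import Order.TTheory GRing.Theory Num.Theory.
Import numFieldNormedType.Exports.

Local Open Scope classical_set_scope.
Local Open Scope ring_scope.

(** Cauchy's formula turns a function of a matrix into a resolvent integral:
    if F z is the integral of g t / (t - z) over Gamma for every z in Omega, and
    the spectrum of M lies in Omega, then F(M) is the integral of
    g t (t - M)^-1 ([matfun_cauchy]).  Applied to f with both A and H, this
    writes f(A) b - beta B f(H) e_1 as the integral of g t times
    (t - A)^-1 b - beta B (t - H)^-1 e_1.

    At a fixed t this difference is purely algebraic.  The Arnoldi relation gives
    (t - A) B = B (t - H) - h b' e_m^T, where h b' is the remainder vector; hence
    the difference is a multiple of (t - A)^-1 b', with factor
    h beta e_m^T (t - H)^-1 e_1 ([arnoldi_resolvent]).  That corner entry of the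
    resolvent of a Hessenberg matrix is the product of the subdiagonal divided by
    the characteristic polynomial, by Cramer's rule
    ([hessenberg_resolvent_corner]).  This proves the first formula.  The second
    one is [matfun_cauchy] again, now for the density g / phi_m, whose Cauchy
    integral is the error function up to a constant.

    The work is in [matfun_cauchy], because a matrix function is defined here by
    Hermite interpolation.  Two facts carry it.
    - The k-th derivative of the Cauchy integral at z is k! times the integral of
      g t / (t - z)^(k+1) ([derive1n_cauchy]).  The contour may be unbounded, so
      the difference quotient is compared with its limit by an explicit bound:
      the remainder is O(h^2) times |g t / (t - z)|, uniformly in t
      ([expr_remainder_le]), and the latter function is integrable.
    - For fixed t let N_t be the Newton polynomial that interpolates 1 / (t - x)
      at the roots, with multiplicity, of the minimal polynomial of M
      ([newton_inv]).  Then N_t(M) = (t - M)^-1, and N_t has at each root z the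
      derivatives k! / (t - z)^(k+1).  Integrating its coefficients against g
      gives a polynomial p such that psi(p) is the integral of g t psi(N_t) for
      every linear form psi ([newton_interpolant]).  Taking for psi a derivative
      at a root shows that p is a Hermite interpolant of F; taking for psi an
      entry of the value at M computes p(M).
 *)

(** * Integrals of complex-valued functions of a real variable *)

Section ComplexValuedIntegral.
Context (R : realType) (D : set R).
Hypothesis mD : measurable (D : set (measurableTypeR R)).
Local Notation mu := (@lebesgue_measure R).
Local Notation C := (Cx R).

Definition cintegrable (u : R -> C) : Prop :=
  mu.-integrable D (fun s => (complex.Re (u s))%:E) /\
  mu.-integrable D (fun s => (complex.Im (u s))%:E).

Definition cintegral (u : R -> C) : C :=
  Complex (\int[mu]_(s in D) complex.Re (u s))
          (\int[mu]_(s in D) complex.Im (u s)).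

(** As for integrability, everything is stated on real and imaginary parts, so
    that real-valued measure theory applies. *)
Definition cmeasurable (w : R -> C) : Prop :=
  measurable_fun (D : set (measurableTypeR R)) (fun s => complex.Re (w s)) /\
  measurable_fun (D : set (measurableTypeR R)) (fun s => complex.Im (w s)).

Definition cbounded (w : R -> C) : Prop :=
  exists M : R, forall s, D s -> `|w s| <= (real_complex R M : C).

Lemma ReD (x y : C) : complex.Re (x + y) = complex.Re x + complex.Re y.
Proof. by case: x y => [a b] [c d]. Qed.

Lemma ImD (x y : C) : complex.Im (x + y) = complex.Im x + complex.Im y.
Proof. by case: x y => [a b] [c d]. Qed.

Lemma ReM (x y : C) :
  complex.Re (x * y) =
  complex.Re x * complex.Re y - complex.Im x * complex.Im y.
Proof. by case: x y => [a b] [c d]. Qed.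

Lemma ImM (x y : C) :
  complex.Im (x * y) =
  complex.Re x * complex.Im y + complex.Im x * complex.Re y.
Proof. by case: x y => [a b] [c d]. Qed.

Lemma ler_Re_norm (x : C) : (real_complex R `|complex.Re x| : C) <= `|x|.
Proof. exact: normc_ge_Re. Qed.

Lemma ler_Im_norm (x : C) : (real_complex R `|complex.Im x| : C) <= `|x|.
Proof.
case: x => a b; rewrite normc_def lecR /= -[leLHS]sqrtr_sqr.
by rewrite ler_wsqrtr// lerDr sqr_ge0.
Qed.

Lemma ler_norm_ReIm (x : C) :
  `|x| <= (real_complex R (`|complex.Re x| + `|complex.Im x|) : C).
Proof.
case: x => a b; rewrite normc_def lecR /= -[leRHS]ger0_norm ?addr_ge0//.
rewrite -sqrtr_sqr ler_wsqrtr// sqrrD !real_normK ?num_real//.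
by rewrite -addrA lerD2l lerDr mulrn_wge0// mulr_ge0.
Qed.

Lemma eq_cintegrable (u v : R -> C) :
  {in D, u =1 v} -> cintegrable u -> cintegrable v.
Proof.
move=> uv [ru iu]; split.
- by apply: (eq_integrable mD _ _ _ ru) => s sD; rewrite uv.
- by apply: (eq_integrable mD _ _ _ iu) => s sD; rewrite uv.
Qed.

Lemma eq_cintegral (u v : R -> C) :
  {in D, u =1 v} -> cintegral u = cintegral v.
Proof.
by move=> uv; congr Complex; apply: eq_Rintegral => s sD; rewrite uv.
Qed.

Lemma cintegrableD (u v : R -> C) :
  cintegrable u -> cintegrable v -> cintegrable (fun s => u s + v s).
Proof.
move=> [ru iu] [rv iv]; split.
- apply: (eq_integrable mD _ _ _ (integrableD mD ru rv)) => s _ /=.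
  by rewrite ReD EFinD.
- apply: (eq_integrable mD _ _ _ (integrableD mD iu iv)) => s _ /=.
  by rewrite ImD EFinD.
Qed.

Lemma cintegralD (u v : R -> C) : cintegrable u -> cintegrable v ->
  cintegral (fun s => u s + v s) = cintegral u + cintegral v.
Proof.
move=> [ru iu] [rv iv]; apply/eqP; rewrite eq_complex ReD ImD /=.
rewrite -!RintegralD//; apply/andP; split; apply/eqP.
- by apply: eq_Rintegral => s _; rewrite ReD.
- by apply: eq_Rintegral => s _; rewrite ImD.
Qed.

Lemma cintegrable_bounded (u w : R -> C) : cintegrable u ->
  cmeasurable w -> cbounded w -> cintegrable (fun s => u s * w s).
Proof.
move=> [ru iu] [rw iw] [M wM].
have bR : [bounded complex.Re (w s) | s in D].
  exists M; split; first exact: num_real.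
  move=> x Mx s /= Ds; rewrite (le_trans _ (ltW Mx))// -lecR.
  exact: le_trans (ler_Re_norm _) (wM _ Ds).
have bI : [bounded complex.Im (w s) | s in D].
  exists M; split; first exact: num_real.
  move=> x Mx s /= Ds; rewrite (le_trans _ (ltW Mx))// -lecR.
  exact: le_trans (ler_Im_norm _) (wM _ Ds).
split.
- apply: (eq_integrable mD _ _ _
    (integrableB mD (integrableMl mD ru rw bR) (integrableMl mD iu iw bI))).
  by move=> s _ /=; rewrite ReM EFinB !EFinM.
- apply: (eq_integrable mD _ _ _
    (integrableD mD (integrableMl mD ru iw bI) (integrableMl mD iu rw bR))).
  by move=> s _ /=; rewrite ImM EFinD !EFinM.
Qed.

(** A constant is a bounded measurable factor. *)
Lemma cintegrableZ (c : C) (u : R -> C) :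
  cintegrable u -> cintegrable (fun s => c * u s).
Proof.
move=> iu; apply: (@eq_cintegrable (fun s => u s * c)) => [s _|].
  by rewrite mulrC.
apply: cintegrable_bounded => //.
by exists (`|complex.Re c| + `|complex.Im c|) => s _; exact: ler_norm_ReIm.
Qed.

Lemma cintegralZ (c : C) (u : R -> C) : cintegrable u ->
  cintegral (fun s => c * u s) = c * cintegral u.
Proof.
move=> [ru iu].
have intZ (a : R) (v : R -> R) : mu.-integrable D (EFin \o v) ->
    mu.-integrable D (EFin \o (fun s => a * v s)).
  move=> iv; apply: (eq_integrable mD _ _ _ (integrableZl mD a iv)) => s _ /=.
  by rewrite EFinM.
apply/eqP; rewrite eq_complex ReM ImM /=.
rewrite -!RintegralZl// -RintegralB ?intZ// -RintegralD ?intZ//.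
apply/andP; split; apply/eqP.
- by apply: eq_Rintegral => s _; rewrite ReM.
- by apply: eq_Rintegral => s _; rewrite ImM.
Qed.

(** The sum of the two moduli stands in for the modulus, to which it is
    equivalent, in order to stay with real and imaginary parts. *)
Definition cmass (v : R -> C) : R :=
  \int[mu]_(s in D) (`|complex.Re (v s)| + `|complex.Im (v s)|).

Lemma cmass_ge0 (v : R -> C) : 0 <= cmass v.
Proof. by apply: Rintegral_ge0 => s _; rewrite addr_ge0. Qed.

(** Real and imaginary parts are estimated separately, whence the factor 2. *)
Lemma cintegral_le (u v : R -> C) (c : R) : 0 <= c ->
  cintegrable u -> cintegrable v ->
  (forall s, D s -> `|u s| <= real_complex R c * `|v s|) ->
  `|cintegral u| <= (real_complex R (c * cmass v *+ 2) : C).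
Proof.
move=> c0 [ru iu] [rv iv] uv.
have sum_int : mu.-integrable D
    (EFin \o (fun s => `|complex.Re (v s)| + `|complex.Im (v s)|)).
  apply: (eq_integrable mD _ _ _
    (integrableD mD (integrable_abse rv) (integrable_abse iv))).
  by move=> s _ /=; rewrite EFinD.
have csum_int : mu.-integrable D
    (EFin \o (fun s => c * (`|complex.Re (v s)| + `|complex.Im (v s)|))).
  by apply: (eq_integrable mD _ _ _ (integrableZl mD c sum_int)).
have pt s : D s ->
    `|u s| <= (real_complex R
      (c * (`|complex.Re (v s)| + `|complex.Im (v s)|)) : C).
  move=> Ds; apply: le_trans (uv _ Ds) _.
  by rewrite rmorphM /= ler_wpM2l ?ler0c// ler_norm_ReIm.
have part (w : R -> R) : mu.-integrable D (EFin \o w) ->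
    (forall s, D s -> (real_complex R `|w s| : C) <= `|u s|) ->
    `|\int[mu]_(s in D) w s| <= c * cmass v.
  move=> iw wu; apply: le_trans (le_normr_Rintegral mD iw) _.
  rewrite -RintegralZl//; apply: le_Rintegral => //.
    exact: (integrable_abse iw).
  by move=> s Ds; rewrite -lecR; exact: le_trans (wu _ Ds) (pt _ Ds).
apply: le_trans (ler_norm_ReIm _) _; rewrite lecR mulr2n lerD//.
- by apply: part => // s _; exact: ler_Re_norm.
- by apply: part => // s _; exact: ler_Im_norm.
Qed.

End ComplexValuedIntegral.

(** * Contour integrals *)

Section ContourIntegral.
Context (R : realType) (Gamma : contour R).
Local Notation C := (Cx R).
Local Notation dom k := [set` arc_dom (arcs Gamma k)].
Implicit Types h r : C -> C.

Let mdom k : measurable (dom k : set (measurableTypeR R)).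
Proof. exact: measurable_itv. Qed.

Lemma contour_integralE h : contour_integral Gamma h =
  \sum_(k < narcs Gamma) cintegral (dom k) (arc_integrand (arcs Gamma k) h).
Proof. by []. Qed.

Lemma eq_arc_integrand h1 h2 (k : 'I_(narcs Gamma)) :
  {in contour_support Gamma, h1 =1 h2} ->
  {in dom k, arc_integrand (arcs Gamma k) h1 =1 arc_integrand (arcs Gamma k) h2}.
Proof.
move=> h12 s; rewrite inE => /= sD; rewrite /arc_integrand h12// inE.
by exists k, s.
Qed.

Lemma eq_contour_integrable h1 h2 : {in contour_support Gamma, h1 =1 h2} ->
  contour_integrable Gamma h1 -> contour_integrable Gamma h2.
Proof.
by move=> h12 ih k; apply: (eq_cintegrable _ (eq_arc_integrand h12) (ih k)).
Qed.

Lemma eq_contour_integral h1 h2 : {in contour_support Gamma, h1 =1 h2} ->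
  contour_integral Gamma h1 = contour_integral Gamma h2.
Proof.
move=> h12; rewrite !contour_integralE; apply: eq_bigr => k _.
exact: eq_cintegral (eq_arc_integrand h12).
Qed.

Lemma contour_integrableD h1 h2 : contour_integrable Gamma h1 ->
  contour_integrable Gamma h2 ->
  contour_integrable Gamma (fun t => h1 t + h2 t).
Proof.
move=> i1 i2 k; apply: (eq_cintegrable _ _ (cintegrableD _ (i1 k) (i2 k))) => //.
by move=> s _; rewrite /arc_integrand mulrDl.
Qed.

Lemma contour_integralD h1 h2 : contour_integrable Gamma h1 ->
  contour_integrable Gamma h2 ->
  contour_integral Gamma (fun t => h1 t + h2 t) =
  contour_integral Gamma h1 + contour_integral Gamma h2.
Proof.
move=> i1 i2; rewrite !contour_integralE -big_split; apply: eq_bigr => k _ /=.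
rewrite -cintegralD//; try exact: (i1 k); try exact: (i2 k).
by apply: eq_cintegral => s _; rewrite /arc_integrand mulrDl.
Qed.

Lemma contour_integrableZ (c : C) h : contour_integrable Gamma h ->
  contour_integrable Gamma (fun t => c * h t).
Proof.
move=> ih k; apply: (eq_cintegrable _ _ (cintegrableZ _ c (ih k))) => //.
by move=> s _; rewrite /arc_integrand mulrA.
Qed.

Lemma contour_integralZ (c : C) h : contour_integrable Gamma h ->
  contour_integral Gamma (fun t => c * h t) = c * contour_integral Gamma h.
Proof.
move=> ih; rewrite !contour_integralE mulr_sumr; apply: eq_bigr => k _ /=.
rewrite -cintegralZ//.
by apply: eq_cintegral => s _; rewrite /arc_integrand mulrA.
Qed.

Lemma contour_integrable0 : contour_integrable Gamma (fun=> 0).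
Proof.
move=> k; apply: (@eq_cintegrable _ _ _ (fun=> 0)) => //.
- by move=> s _; rewrite /arc_integrand mul0r.
- by split; exact: integrable0.
Qed.

Lemma contour_integral0 : contour_integral Gamma (fun=> 0) = 0.
Proof.
rewrite (@eq_contour_integral _ (fun t => 0 * (fun=> 0) t)).
  by rewrite contour_integralZ ?mul0r//; exact: contour_integrable0.
by move=> t _; rewrite mul0r.
Qed.

Lemma contour_integrable_sum (I : Type) (s : seq I) (h : I -> C -> C) :
  (forall i, contour_integrable Gamma (h i)) ->
  contour_integrable Gamma (fun t => \sum_(i <- s) h i t).
Proof.
move=> ih; elim: s => [|i s IHs].
  apply: eq_contour_integrable contour_integrable0 => t _.
  by rewrite big_nil.
apply: eq_contour_integrable (contour_integrableD (ih i) IHs) => t _.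
by rewrite big_cons.
Qed.

Lemma contour_integral_sum (I : Type) (s : seq I) (h : I -> C -> C) :
  (forall i, contour_integrable Gamma (h i)) ->
  contour_integral Gamma (fun t => \sum_(i <- s) h i t) =
  \sum_(i <- s) contour_integral Gamma (h i).
Proof.
move=> ih; elim: s => [|i s IHs].
  rewrite big_nil -[RHS]contour_integral0.
  by apply: eq_contour_integral => t _; rewrite big_nil.
rewrite big_cons -IHs -contour_integralD//; last exact: contour_integrable_sum.
by apply: eq_contour_integral => t _; rewrite big_cons.
Qed.

(** The factors by which an integrable function on the contour can be multiplied
    without losing integrability. *)
Definition contour_multiplier r : Prop := forall k : 'I_(narcs Gamma),
  cmeasurable (dom k) (r \o arc_fun (arcs Gamma k)) /\
  cbounded (dom k) (r \o arc_fun (arcs Gamma k)).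

Lemma contour_integrableM h r : contour_integrable Gamma h ->
  contour_multiplier r -> contour_integrable Gamma (fun t => h t * r t).
Proof.
move=> ih mr k; have [mrk brk] := mr k.
apply: (eq_cintegrable _ _ (cintegrable_bounded _ (ih k) mrk brk)) => //.
by move=> s _; rewrite /arc_integrand /= mulrAC.
Qed.

Lemma contour_multiplier_cst (c : C) : contour_multiplier (fun=> c).
Proof.
move=> k; split; first by split; exact: measurable_cst.
by exists (`|complex.Re c| + `|complex.Im c|) => s _; exact: ler_norm_ReIm.
Qed.

Lemma contour_multiplierM r1 r2 : contour_multiplier r1 ->
  contour_multiplier r2 -> contour_multiplier (fun t => r1 t * r2 t).
Proof.
move=> m1 m2 k; have [[mr1 mi1] [M1 b1]] := m1 k.
have [[mr2 mi2] [M2 b2]] := m2 k; split; last first.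
  exists (M1 * M2) => s Ds /=; rewrite rmorphM normrM /=.
  by rewrite ler_pM//; [exact: b1|exact: b2].
split.
- rewrite (_ : (fun _ => _) =
    ((fun s => complex.Re ((r1 \o arc_fun (arcs Gamma k)) s)) \*
    (fun s => complex.Re ((r2 \o arc_fun (arcs Gamma k)) s))) \-
    ((fun s => complex.Im ((r1 \o arc_fun (arcs Gamma k)) s)) \*
    (fun s => complex.Im ((r2 \o arc_fun (arcs Gamma k)) s)))).
    by apply: measurable_funB; exact: measurable_realfun.measurable_funM.
  by apply/funext => s; rewrite /= ReM.
- rewrite (_ : (fun _ => _) =
    ((fun s => complex.Re ((r1 \o arc_fun (arcs Gamma k)) s)) \*
    (fun s => complex.Im ((r2 \o arc_fun (arcs Gamma k)) s))) \+
    ((fun s => complex.Im ((r1 \o arc_fun (arcs Gamma k)) s)) \*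
    (fun s => complex.Re ((r2 \o arc_fun (arcs Gamma k)) s)))).
    by apply: measurable_funD; exact: measurable_realfun.measurable_funM.
  by apply/funext => s; rewrite /= ImM.
Qed.

(** The constant depends only on the dominating function, and not on the factor
    c: letting c tend to 0 then makes a family of integrals vanish, even when the
    contour has infinite length. *)
Lemma contour_integral_le h0 : contour_integrable Gamma h0 ->
  exists2 K : C, 0 <= K & forall (c : C) h, 0 <= c ->
    contour_integrable Gamma h ->
    (forall t, contour_support Gamma t -> `|h t| <= c * `|h0 t|) ->
    `|contour_integral Gamma h| <= c * K.
Proof.
move=> ih0.
exists (\sum_(k < narcs Gamma)
  (real_complex R (cmass (dom k) (arc_integrand (arcs Gamma k) h0) *+ 2) : C)).
  by apply: sumr_ge0 => k _; rewrite ler0c mulrn_wge0// cmass_ge0.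
move=> c h c0 ih hle; have cE : real_complex R (complex.Re c) = c.
  by apply: RRe_real; exact: ger0_real.
have Rec0 : 0 <= complex.Re c by rewrite -ler0c cE.
rewrite contour_integralE mulr_sumr; apply: le_trans (ler_norm_sum _ _ _) _.
apply: ler_sum => k _; rewrite -[in leRHS]cE -rmorphM /= mulrnAr.
apply: cintegral_le => //.
move=> s Ds; rewrite cE /arc_integrand !normrM mulrA ler_wpM2r//.
by apply: hle; exists k, s.
Qed.

End ContourIntegral.

(** * The Cauchy kernel along a contour *)

Section CauchyKernel.
Context (R : realType) (Gamma : contour R) (Omega : set (Cx R)).
Hypothesis Omega_open : open Omega.
Hypothesis Gamma_out : contour_support Gamma `<=` ~` Omega.
Local Notation C := (Cx R).

(** Points of the contour stay away from a whole neighbourhood of a point of the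
    open set Omega, because they lie outside Omega; half the radius of a ball
    contained in Omega will do. *)
Lemma contour_dist_gt0 (z : C) : Omega z -> exists2 d : C, 0 < d &
  forall w, `|w - z| < d -> Omega w /\
    forall t, contour_support Gamma t -> d <= `|t - w|.
Proof.
move=> Oz; have /nbhs_ballP[e /= e0 eO] : nbhs z Omega.
  exact: open_nbhs_nbhs.
exists (e / 2); first by rewrite divr_gt0.
move=> w wz; split.
  apply: eO; rewrite -ball_normE /= distrC (lt_le_trans wz)//.
  by rewrite ler_pdivrMr// mulr_natr mulr2n lerDl ltW.
move=> t Gt; rewrite -(lerD2l `|w - z|).
have et : e <= `|t - z|.
  have : ~ (ball z e t) by move=> /eO; exact: Gamma_out.
  rewrite -ball_normE /= distrC => /negP.
  by rewrite -real_leNgt ?ger0_real// ltW.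
have : e <= `|w - z| + `|t - w|.
  apply: le_trans et _; rewrite -(subrKA w t (- z)) [leRHS]addrC.
  exact: ler_normD.
apply: le_trans; rewrite [leRHS](splitr e) lerD2r ltW//.
Qed.

Lemma contour_neq (z t : C) : Omega z -> contour_support Gamma t ->
  t - z != 0.
Proof.
by move=> Oz Gt; rewrite subr_eq0; apply: contra_not_neq (Gamma_out Gt) => ->.
Qed.

(** The kernel is continuous along each arc, hence measurable, and it is bounded
    by the inverse of the distance from a to the contour. *)
Lemma contour_multiplier_inv (a : C) : Omega a ->
  contour_multiplier Gamma (fun t => (t - a)^-1).
Proof.
move=> Oa k; set dom := [set` arc_dom (arcs Gamma k)].
set r := (X in cmeasurable _ X).
have r_cts s : dom s -> r @ within dom (nbhs s) --> r s.
  move=> Ds; have [gamma_cts _] := arcs_smooth (c := Gamma) k.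
  move/subspace_continuousP: gamma_cts => /(_ s Ds) gs.
  apply: cvgV; first by apply: contour_neq => //; exists k, s.
  exact: cvgB gs (cvg_cst _).
(* p is the real or the imaginary part. *)
have part_cts (p : C -> R) : (forall x y, p (x - y) = p x - p y) ->
    (forall x, (real_complex R `|p x| : C) <= `|x|) ->
    measurable_fun (dom : set (measurableTypeR R)) (fun s => p (r s)).
  move=> pB p_le; apply: subspace_continuous_measurable_fun.
    exact: measurable_itv.
  apply/subspace_continuousP => s Ds.
  apply/cvgrPdist_lt => e e0.
  have eC0 : 0 < (real_complex R e : C) by rewrite (ltcR 0).
  have /cvgrPdist_lt/(_ _ eC0) := r_cts s Ds; apply: filterS => x xe.
  by rewrite -ltcR -pB; exact: le_lt_trans (p_le _) xe.
split.
  split; apply: part_cts.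
  - by move=> [a1 a2] [b1 b2].
  - exact: ler_Re_norm.
  - by move=> [a1 a2] [b1 b2].
  - exact: ler_Im_norm.
have [d d0 /(_ a)] := contour_dist_gt0 Oa.
rewrite subrr normr0 => /(_ d0)[_ dt].
exists (complex.Re d^-1) => s Ds; rewrite RRe_real; last first.
  by rewrite ger0_real// invr_ge0 ltW.
by rewrite /r /= normfV lef_pV2 ?posrE ?normr_gt0 ?dt//;
  [exists k, s|apply: contour_neq => //; exists k, s].
Qed.

Lemma contour_multiplier_prod (I : Type) (s : seq I) (a : I -> C) :
  (forall i, Omega (a i)) ->
  contour_multiplier Gamma (fun t => (\prod_(i <- s) (t - a i))^-1).
Proof.
move=> Oa; elim: s => [|i s IHs].
  under eq_fun do rewrite big_nil invr1.
  exact: contour_multiplier_cst.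
under eq_fun do rewrite big_cons invfM.
exact: contour_multiplierM (contour_multiplier_inv (Oa i)) IHs.
Qed.

Definition cauchy_density (g : C -> C) : Prop :=
  forall z, Omega z -> contour_integrable Gamma (fun t => g t / (t - z)).

Lemma cauchy_densityM (g r : C -> C) : cauchy_density g ->
  contour_multiplier Gamma r -> cauchy_density (fun t => g t * r t).
Proof.
move=> gd mr z Oz.
apply: eq_contour_integrable (contour_integrableM (gd z Oz) mr) => t _.
by rewrite mulrAC.
Qed.

Lemma cauchy_integrableX (g : C -> C) (z : C) (k : nat) : cauchy_density g ->
  Omega z -> contour_integrable Gamma (fun t => g t * (t - z)^-1 ^+ k.+1).
Proof.
move=> gd Oz; elim: k => [|k IHk].
  by apply: eq_contour_integrable (gd z Oz) => t _; rewrite expr1.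
have := contour_integrableM IHk (contour_multiplier_inv Oz).
by apply: eq_contour_integrable => t _; rewrite [in RHS]exprSr mulrA.
Qed.

End CauchyKernel.

(** With u = 1 / (t - z - h) and v = 1 / (t - z), this bounds the second order
    Taylor remainder of 1 / (t - x)^n.  One factor |v| is kept apart, because only
    g v, and not g itself, is known to be integrable along the contour. *)
Lemma expr_remainder_le (C : numDomainType) (M : C) (n : nat) : 0 <= M ->
  exists2 K : C, 0 <= K & forall u v h : C, `|u| <= M -> `|v| <= M ->
    u - v = h * (u * v) ->
    `|u ^+ n - v ^+ n - h * (n%:R * v ^+ n.+1)| <= K * `|h| ^+ 2 * `|v|.
Proof.
move=> M0; elim: n => [|n [K K0 IHn]].
  exists 0 => // u v h _ _ _.
  by rewrite !expr0 subrr mul0r mulr0 subr0 normr0 !mul0r.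
exists (M * K + n.+1%:R * M ^+ n.+2).
  by apply: addr_ge0; [exact: mulr_ge0|];  rewrite mulr_ge0 ?exprn_ge0.
move=> u v h uM vM uv.
(* The relation between u and v is used twice: to split u^(n+1) - v^(n+1), and to
   replace h v^(n+2) by h v^(n+1) u at the cost of a term in h^2. *)
have -> : u ^+ n.+1 - v ^+ n.+1 - h * (n.+1%:R * v ^+ n.+2) =
    u * (u ^+ n - v ^+ n - h * (n%:R * v ^+ n.+1)) +
    n.+1%:R * h ^+ 2 * (u * v ^+ n.+1) * v.
  have -> : n.+1%:R * h ^+ 2 * (u * v ^+ n.+1) * v =
      n.+1%:R * h * v ^+ n.+1 * (h * (u * v)) by rewrite !exprS; ring.
  have -> : u ^+ n.+1 - v ^+ n.+1 - h * (n.+1%:R * v ^+ n.+2) =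
      u * (u ^+ n - v ^+ n) + (h * (u * v)) * v ^+ n
       - h * (n.+1%:R * v ^+ n.+2) by rewrite -uv !exprS; ring.
  by rewrite -[in RHS]uv -natr1 !exprS; ring.
apply: le_trans (ler_normD _ _) _.
rewrite -[leRHS]mulrA [leRHS]mulrDl; apply: lerD.
  rewrite normrM -[leRHS]mulrA; apply: ler_pM => //.
  by rewrite [leRHS]mulrA; exact: IHn.
rewrite !normrM !normrX normr_nat.
have -> : n.+1%:R * `|h| ^+ 2 * (`|u| * `|v| ^+ n.+1) * `|v| =
    (n.+1%:R * (`|u| * `|v| ^+ n.+1)) * (`|h| ^+ 2 * `|v|) by ring.
apply: ler_wpM2r; first by rewrite mulr_ge0 ?exprn_ge0.
rewrite ler_wpM2l// [leRHS]exprS ler_pM ?exprn_ge0//.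
by rewrite lerXn2r ?nnegrE.
Qed.

Lemma is_derive_quadratic (C : numFieldType) (f : C -> C) (z l d K : C) :
  0 < d -> 0 <= K ->
  (forall h, `|h| < d -> `|f (h + z) - f z - h * l| <= K * `|h| ^+ 2) ->
  is_derive z 1 f l.
Proof.
move=> d0 K0 fl.
have cl : (fun h => h^-1 *: ((f \o shift z) (h *: 1) - f z)) @ 0^' --> l.
  apply/cvgrPdist_lt => e e0; near=> h.
  have h0 : h != 0 by near: h; exact: nbhs_dnbhs_neq.
  have hd : `|h| < d.
    by near: h; exact: dnbhs0_lt.
  have he : `|h| < e / (K + 1).
    near: h; apply: dnbhs0_lt.
    by rewrite divr_gt0// ltr_wpDl.
  rewrite /= distrC.
  have -> : h^-1 *: (f (h *: 1 + z) - f z) - l =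
      h^-1 * (f (h + z) - f z - h * l).
    by rewrite [h *: 1]mulr1 mulrBr mulKf.
  rewrite normrM normfV mulrC ltr_pdivrMr ?normr_gt0//.
  apply: le_lt_trans (fl h hd) _.
  rewrite expr2 mulrA ltr_pM2r ?normr_gt0//.
  apply: (@le_lt_trans _ _ (`|h| * (K + 1))); last by rewrite -ltr_pdivlMr ?ltr_wpDl.
  by rewrite mulrC ler_wpM2l// lerDl.
apply: DeriveDef; first by apply/cvg_ex; exists l.
exact: cvg_lim cl.
Unshelve. all: by end_near. Qed.

(** * Derivatives of Cauchy integrals *)

Lemma invrB_resolvent (F : fieldType) (t z h : F) :
  t - z != 0 -> t - (h + z) != 0 ->
  (t - (h + z))^-1 - (t - z)^-1 = h * ((t - (h + z))^-1 * (t - z)^-1).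
Proof. by move=> tz tw; field; rewrite tz tw. Qed.

(** Stated over an abstract ring, this identity splits the integrand of the Taylor
    remainder into integrals of powers of the kernel. *)
Lemma remainder_splitE (F : comPzRingType) (g a b c h n : F) :
  g * a + (-1) * (g * b) + (- h * n) * (g * c) = g * (a - b - h * (n * c)).
Proof. ring. Qed.

Section CauchyDerivatives.
Context (R : realType) (Gamma : contour R) (Omega : set (Cx R)).
Hypothesis Omega_open : open Omega.
Hypothesis Gamma_out : contour_support Gamma `<=` ~` Omega.
Local Notation C := (Cx R).

Definition cauchy_power (g : C -> C) (k : nat) (z : C) : C :=
  contour_integral Gamma (fun t => g t * (t - z)^-1 ^+ k.+1).

(** Differentiation under the integral sign.  On a ball around z whose points stay
    at distance at least d from the contour, the kernels are bounded by 1 / d, and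
    the remainder is at most a constant times |h|^2 |g t / (t - z)|. *)
Lemma is_derive_cauchy_power (g : C -> C) (k : nat) (z : C) :
  cauchy_density Gamma Omega g -> Omega z ->
  is_derive z 1 (cauchy_power g k) (k.+1%:R * cauchy_power g k.+1 z).
Proof.
move=> gd Oz; have [d d0 zd] := contour_dist_gt0 Omega_open Gamma_out Oz.
have M0 : 0 <= d^-1 by rewrite invr_ge0 ltW.
have [K1 K10 rem_le] := @expr_remainder_le C d^-1 k.+1 M0.
have gX w j (Ow : Omega w) :=
  cauchy_integrableX Omega_open Gamma_out j gd Ow.
have [K2 K20 int_le] := contour_integral_le (gd z Oz).
apply: (@is_derive_quadratic _ _ _ _ d (K1 * K2)) => // [|h hd].
  exact: mulr_ge0.
have [] := zd (h + z); first by rewrite addrK.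
move=> Ow wd; have := zd z; rewrite subrr normr0 => /(_ d0)[_ zzd].
pose u t := (t - (h + z))^-1; pose v t := (t - z)^-1.
pose rem t := u t ^+ k.+1 - v t ^+ k.+1 - h * (k.+1%:R * v t ^+ k.+2).
have remE t : g t * u t ^+ k.+1 + (-1) * (g t * v t ^+ k.+1) +
    (- h * k.+1%:R) * (g t * v t ^+ k.+2) = g t * rem t.
  exact: remainder_splitE.
have i1 : contour_integrable Gamma
    (fun t => g t * u t ^+ k.+1 + (-1) * (g t * v t ^+ k.+1)).
  by apply: contour_integrableD; [|apply: contour_integrableZ]; exact: gX.
have i2 := contour_integrableZ (- h * k.+1%:R) (gX z k.+1 Oz).
have irem : contour_integrable Gamma (fun t => g t * rem t).
  by apply: eq_contour_integrable (contour_integrableD i1 i2) => t _.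
have -> : cauchy_power g k (h + z) - cauchy_power g k z -
    h * (k.+1%:R * cauchy_power g k.+1 z) =
    contour_integral Gamma (fun t => g t * rem t).
  rewrite -(eq_contour_integral (fun t _ => remE t)).
  rewrite contour_integralD// contour_integralD; [|exact: gX|]; last first.
    by apply: contour_integrableZ; exact: gX.
  rewrite !contour_integralZ; [|exact: gX..].
  by rewrite mulN1r !mulNr -mulrA.
rewrite mulrAC; apply: int_le => // [|t Gt].
  by rewrite mulr_ge0 ?exprn_ge0.
have tz := contour_neq Gamma_out Oz Gt.
have tw := contour_neq Gamma_out Ow Gt.
have inv_le x : x != 0 -> d <= `|x| -> `|x^-1| <= d^-1.
  by move=> x0 dx; rewrite normfV lef_pV2 ?posrE ?normr_gt0.
rewrite !normrM mulrCA ler_wpM2l//; apply: rem_le.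
- by apply: inv_le => //; exact: wd.
- by apply: inv_le => //; exact: zzd.
- exact: invrB_resolvent.
Qed.

Lemma derive1n_cauchy (g F : C -> C) (k : nat) (z : C) :
  cauchy_density Gamma Omega g ->
  (forall w, Omega w -> F w = contour_integral Gamma (fun t => g t / (t - w))) ->
  Omega z -> derive1n k F z = k`!%:R * cauchy_power g k z.
Proof.
move=> gd FE; elim: k z => [|k IHk] z Oz.
  rewrite derive1n0 FE// fact0 mul1r; apply: eq_contour_integral => t _.
  by rewrite expr1.
rewrite derive1nS derive1E.
have -> : 'D_1 (derive1n k F) z =
    'D_1 (fun w => k`!%:R * cauchy_power g k w) z.
  apply: near_eq_derive; near=> w; apply: IHk; near: w.
  exact: open_nbhs_nbhs.
have dk := is_derive_cauchy_power k gd Oz.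
have := is_deriveZ (k`!%:R : C) dk.
move=> /@derive_val ->.
by rewrite /GRing.scale /= factS natrM mulrA [_%:R * k.+1%:R]mulrC.
Unshelve. all: by end_near. Qed.

End CauchyDerivatives.

(** * Multiplicities and Newton interpolation of the Cauchy kernel *)

Section PolynomialMultiplicity.
Variable F : numFieldType.
Implicit Types (p q : {poly F}) (s : seq F) (z t : F).

Lemma horner_derivn_XsubCX z k j q : (j <= k)%N ->
  ((('X - z%:P) ^+ k * q)^`(j)).[z] = (j == k)%:R * (k`!%:R * q.[z]).
Proof.
elim: j k q => [|j IHj] [|k] q //.
- by rewrite derivn0 expr0 !mul1r.
- by rewrite derivn0 exprS -mulrA hornerM hornerXsubC subrr !mul0r.
rewrite ltnS => jk; rewrite derivSn.
have -> : (('X - z%:P) ^+ k.+1 * q)^`() =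
    ('X - z%:P) ^+ k * (q *+ k.+1 + ('X - z%:P) * q^`()).
  by rewrite derivM deriv_exp derivXsubC mul1r /= mulrDr exprSr mulrA mulrnAl mulrnAr.
rewrite IHj// eqSS hornerD hornerM hornerXsubC subrr mul0r addr0.
congr (_ * _).
by rewrite hornerMn mulrnAr -mulrnAl -mulrnA mulnC -factS.
Qed.

(** Characteristic 0 enters here: if (X - z)^k divides p with quotient q, then the
    k-th derivative of p at z is k! q(z), so its vanishing lets one more factor
    X - z divide p. *)
Lemma dvdp_XsubCX_derivn z k p :
  (forall j, (j < k)%N -> (p^`(j)).[z] = 0) -> ('X - z%:P) ^+ k %| p.
Proof.
elim: k => [|k IHk] pz; first by rewrite expr0 dvd1p.
have /dvdpP[q qE] : ('X - z%:P) ^+ k %| p.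
  by apply: IHk => j jk; apply: pz; rewrite ltnS ltnW.
have := pz k (ltnSn k); rewrite qE mulrC horner_derivn_XsubCX// eqxx mul1r.
move=> /eqP; rewrite mulf_eq0 pnatr_eq0 -leqn0 leqNgt fact_gt0 /=.
by rewrite exprSr dvdp_mul2l ?expf_neq0 ?polyXsubC_eq0// dvdp_XsubCl.
Qed.

Lemma prod_XsubC_dvdp s p :
  (forall z, ('X - z%:P) ^+ (count_mem z s) %| p) ->
  \prod_(a <- s) ('X - a%:P) %| p.
Proof.
elim: s p => [|a s IHs] p dvd_p; first by rewrite big_nil dvd1p.
have /dvdpP[q qE] : 'X - a%:P %| p.
  by apply: dvdp_trans (dvd_p a); rewrite /= eqxx add1n exprS dvdp_mulr.
rewrite big_cons qE mulrC dvdp_mul2r ?polyXsubC_eq0//.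
apply: IHs => z; have := dvd_p z; rewrite qE /=.
have [<-|az] := eqVneq a z.
  by rewrite add1n exprSr dvdp_mul2r// polyXsubC_eq0.
rewrite add0n mulrC Gauss_dvdpr//.
by apply: coprimep_expl; rewrite coprimep_XsubC /root hornerXsubC subr_eq0.
Qed.

(** The Newton form of the polynomial in X that interpolates 1 / (t - X) at the
    nodes s, repeated nodes being understood in the sense of Hermite.  The
    recursion is the identity 1 / (t - X) = (1 + (X - a) / (t - X)) / (t - a). *)
Fixpoint newton_inv t s : {poly F} :=
  if s is a :: s' then (t - a)^-1 *: (1 + ('X - a%:P) * newton_inv t s')
  else 0.

Lemma newton_invE t s : t \notin s ->
  (t%:P - 'X) * newton_inv t s =
  1 - (\prod_(a <- s) (t - a))^-1 *: \prod_(a <- s) ('X - a%:P).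
Proof.
elim: s => [|a s IHs] /=; first by rewrite !big_nil mulr0 invr1 scale1r subrr.
rewrite inE negb_or => /andP[ta /IHs {}IHs].
rewrite !big_cons -scalerAr mulrDr mulr1 mulrCA IHs mulrBr mulr1 addrA.
have -> : t%:P - 'X + ('X - a%:P) = (t - a)%:P.
  by rewrite addrA subrK polyCB.
have one : (t - a)^-1 *: (t - a)%:P = 1 :> {poly F}.
  by rewrite -mul_polyC -polyCM mulVf ?subr_eq0.
by rewrite scalerBr one invfM -scalerA -scalerAr.
Qed.

Lemma derivn_CsubXM t k p :
  ((t%:P - 'X) * p)^`(k) = (t%:P - 'X) * p^`(k) - p^`(k.-1) *+ k.
Proof.
elim: k => [|k IHk]; first by rewrite !derivn0 mulr0n subr0.
rewrite derivnS IHk derivB derivM derivB derivC derivX derivMn sub0r mulN1r.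
rewrite -!derivnS /= [- _ + _]addrC -addrA -opprD; congr (_ - _).
by case: k {IHk} => [|k] /=; rewrite ?mulr0n ?addr0// mulrS.
Qed.

(** The product (t - X) N_t equals 1 up to a multiple of the nodal polynomial,
    which vanishes at z to the order of the multiplicity.  Leibniz' rule turns this
    into the recursion satisfied by the derivatives of 1 / (t - X) at z. *)
Lemma newton_inv_derivn t s z k : t \notin s -> (k < count_mem z s)%N ->
  ((newton_inv t s)^`(k)).[z] = k`!%:R * (t - z)^-1 ^+ k.+1.
Proof.
move=> ts kz; have z_in : z \in s.
  by rewrite -has_pred1 has_count (leq_ltn_trans _ kz).
have tz : t - z != 0 by rewrite subr_eq0; apply: contraNneq ts => ->.
have nodal_dvd : ('X - z%:P) ^+ (count_mem z s) %| \prod_(a <- s) ('X - a%:P).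
  by rewrite -mup_geq ?mu_prod_XsubC// prodf_seq_neq0; apply/allP => a _;
    rewrite polyXsubC_eq0.
have rec j : (j < count_mem z s)%N -> (t - z) * ((newton_inv t s)^`(j)).[z] =
    (j == 0%N)%:R + ((newton_inv t s)^`(j.-1)).[z] *+ j.
  move=> jz; apply/eqP; rewrite -subr_eq; apply/eqP.
  have := congr1 (fun p => (p^`(j)).[z]) (newton_invE ts).
  rewrite derivn_CsubXM !hornerE hornerMn => ->.
  have /dvdpP[q ->] := nodal_dvd.
  rewrite [q * _]mulrC derivnB derivnZ !hornerE horner_derivn_XsubCX ?(ltnW jz)//.
  rewrite (ltn_eqF jz) mul0r mulr0 subr0.
  by case: j {jz} => [|j]; rewrite ?derivn0 ?hornerE// derivSn derivC linear0 hornerE.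
apply: (mulfI tz); elim: k kz => [|k IHk] kz; rewrite rec//.
  by rewrite mulr0n addr0 fact0 mul1r expr1 mulfV.
rewrite add0r; have := IHk (ltnW kz); move=> /(mulfI tz) /= ->.
rewrite -mulr_natl factS natrM [X in _ = _ * (_ * X)]exprS.
by rewrite [RHS]mulrCA mulVKf// mulrA.
Qed.

End PolynomialMultiplicity.

(** * Resolvents of Hessenberg matrices and of the Arnoldi relation *)

Section ResolventAlgebra.
Variable F : numFieldType.

(** The nodal polynomial annihilates A, so the interpolation error of [newton_invE]
    disappears. *)
Lemma horner_mx_newton_inv n (A : 'M[F]_n.+1) (t : F) (s : seq F) :
  t \notin s -> horner_mx A (\prod_(a <- s) ('X - a%:P)) = 0 ->
  horner_mx A (newton_inv t s) = invmx (t%:M - A).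
Proof.
move=> ts A0; have := congr1 (horner_mx A) (newton_invE ts).
rewrite rmorphM !rmorphB /= horner_mx_C horner_mx_X linearZ /= A0 scaler0 subr0.
rewrite rmorph1 => RA; have [RU _] := mulmx1_unit RA.
rewrite -[LHS](mulKmx RU) -[RHS]mulmx1; congr (_ *m _); exact: RA.
Qed.

Lemma horner_char_polyE n (H : 'M[F]_n) (t : F) :
  (char_poly H).[t] = \det (t%:M - H).
Proof.
rewrite /char_poly -horner_evalE -det_map_mx; congr (\det _).
apply/matrixP => i j; rewrite !mxE /= horner_evalE !hornerE.
by rewrite hornerMn hornerX.
Qed.

(** Deleting the first row and the last column of t - H leaves an upper triangular
    matrix whose diagonal is the negated subdiagonal of H; the m signs are
    compensated by the sign of the cofactor. *)
Lemma hessenberg_cofactor m (H : 'M[F]_m.+1) (t : F) :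
  (forall i j : 'I_m.+1, (j.+1 < i)%N -> H i j = 0) ->
  cofactor (t%:M - H) ord0 ord_max =
  \prod_(j < m) H (inord j.+1) (inord j).
Proof.
move=> hess; rewrite /cofactor -det_tr det_trig; last first.
  apply/is_trig_mxP => i j ij; rewrite !mxE /=.
  have -> : (lift ord0 j == lift ord_max i) = false.
    by rewrite -(inj_eq (@ord_inj _)) lift0 lift_max gtn_eqF// ltnW.
  rewrite mulr0n sub0r hess ?oppr0//.
  by rewrite lift0 lift_max ltnS.
have -> : \prod_(i < m) (row' ord0 (col' ord_max (t%:M - H)))^T i i =
    \prod_(i < m) ((-1) * H (inord i.+1) (inord i)).
  apply: eq_bigr => i _; rewrite !mxE mulN1r.
  have -> : lift ord0 i = inord i.+1.
    by apply: ord_inj; rewrite lift0 /= inordK ?ltnS.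
  have -> : lift ord_max i = inord i.
    by apply: ord_inj; rewrite lift_max /= inordK ?(ltn_trans (ltn_ord i)).
  rewrite -val_eqE /= !inordK ?ltnS ?(ltnW (ltn_ord i))//.
  by rewrite gtn_eqF// mulr0n sub0r.
rewrite big_split /= prodr_const card_ord mulrA -exprD /= add0n.
by rewrite -signr_odd addnn odd_double mul1r.
Qed.

Lemma hessenberg_resolvent_corner m (H : 'M[F]_m.+1) (t : F) :
  (forall i j : 'I_m.+1, (j.+1 < i)%N -> H i j = 0) ->
  t%:M - H \in unitmx ->
  invmx (t%:M - H) ord_max ord0 =
  (\prod_(j < m) H (inord j.+1) (inord j)) / (char_poly H).[t].
Proof.
move=> hess tH; rewrite /invmx tH !mxE hessenberg_cofactor// horner_char_polyE.
by rewrite mulrC.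
Qed.

(** The Arnoldi relation is invariant under the shift by t; multiplying it by
    (t - A)^-1 on the left and by (t - H)^-1 on the right compares the two
    resolvents. *)
Lemma arnoldi_resolvent n m (A : 'M[F]_n) (b : 'cV[F]_n) (B : 'M[F]_(n, m.+1))
    (H : 'M[F]_m.+1) (bnext : 'cV[F]_n) (hnext beta t : F) :
  A *m B = B *m H + (hnext *: bnext) *m delta_mx ord0 ord_max ->
  (forall i j : 'I_m.+1, (j.+1 < i)%N -> H i j = 0) ->
  b = beta *: col ord0 B ->
  t%:M - A \in unitmx -> t%:M - H \in unitmx ->
  invmx (t%:M - A) *m b =
    (beta *: B) *m invmx (t%:M - H) *m delta_mx ord0 ord0 +
    ((\prod_(j < m) H (inord j.+1) (inord j)) * hnext * beta
      / (char_poly H).[t]) *: (invmx (t%:M - A) *m bnext).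
Proof.
move=> AB hess bE tA tH.
have shifted : (t%:M - A) *m B =
    B *m (t%:M - H) - (hnext *: bnext) *m delta_mx ord0 ord_max.
  rewrite mulmxBl mulmxBr AB opprD addrA; congr (_ - _ - _).
  by rewrite mul_scalar_mx mul_mx_scalar.
have BR : invmx (t%:M - A) *m B = B *m invmx (t%:M - H) +
    invmx (t%:M - A) *m (hnext *: bnext) *m
      (delta_mx ord0 ord_max *m invmx (t%:M - H)).
  rewrite -[in LHS](mulmxK tH B) -[in LHS](subrK ((hnext *: bnext) *m
    delta_mx ord0 ord_max) (B *m (t%:M - H))) -shifted mulmxDl mulmxDr.
  by rewrite !mulmxA mulVmx// mul1mx.
have corner : (delta_mx ord0 ord_max : 'rV_m.+1) *m invmx (t%:M - H) *m
    (delta_mx ord0 ord0 : 'cV_m.+1) =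
    ((\prod_(j < m) H (inord j.+1) (inord j)) / (char_poly H).[t])%:M.
  rewrite -hessenberg_resolvent_corner// [LHS]mx11_scalar -rowE -colE.
  by rewrite !mxE.
rewrite bE colE -scalemxAr mulmxA BR mulmxDl.
rewrite -(mulmxA (invmx (t%:M - A) *m _) _ (delta_mx ord0 ord0)).
rewrite corner mul_mx_scalar scalerDr -!scalemxAl -scalemxAr !scalerA.
by congr (_ + _ *: _); ring.
Qed.

(** The same identity, weighted by the density and written as two-sided products
    with constant matrices: in this shape each term integrates entrywise. *)
Lemma arnoldi_weighted_resolvent n m (A : 'M[F]_n) (b : 'cV[F]_n)
    (B : 'M[F]_(n, m.+1)) (H : 'M[F]_m.+1) (bnext : 'cV[F]_n)
    (hnext beta g t : F) :
  A *m B = B *m H + (hnext *: bnext) *m delta_mx ord0 ord_max ->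
  (forall i j : 'I_m.+1, (j.+1 < i)%N -> H i j = 0) ->
  b = beta *: col ord0 B ->
  t%:M - A \in unitmx -> t%:M - H \in unitmx ->
  1%:M *m (g *: invmx (t%:M - A)) *m b =
    ((\prod_(j < m) H (inord j.+1) (inord j) * hnext * beta)%:M
      *m ((g / (char_poly H).[t]) *: invmx (t%:M - A)) *m bnext) +
    (beta *: B) *m (g *: invmx (t%:M - H)) *m delta_mx ord0 ord0.
Proof.
move=> AB hess bE tA tH.
rewrite mul1mx -[(g *: _) *m b]scalemxAl (arnoldi_resolvent AB hess bE tA tH) scalerDr addrC.
rewrite mul_scalar_mx -!scalemxAr -!scalemxAl !scalerA.
by congr (_ *: _ + _); ring.
Qed.

End ResolventAlgebra.

(** * Matrix functions as resolvent integrals *)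

Lemma mulmx3E (F : comPzRingType) p q r s (P : 'M[F]_(p, q)) (X : 'M[F]_(q, r))
    (Q : 'M[F]_(r, s)) i j :
  (P *m X *m Q) i j = \sum_k \sum_l (Q k j * P i l) * X l k.
Proof.
rewrite mxE; apply: eq_bigr => k _; rewrite mxE mulr_suml.
by apply: eq_bigr => l _; rewrite [LHS]mulrC mulrA.
Qed.

Section MatrixFunctions.
Context (R : realType).
Local Notation C := (Cx R).

(** Two interpolants differ by a polynomial that vanishes at each root of the
    minimal polynomial to the order of its multiplicity, hence by a multiple of the
    minimal polynomial. *)
Lemma matfunE n (f : C -> C) (M : 'M[C]_n.+1) (p : {poly C}) :
  hermite_interpolates f M p -> matfun f M = horner_mx M p.
Proof.
move=> fp; rewrite /matfun; set q := xget _ _.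
have fq : hermite_interpolates f M q.
  by apply: (@xgetPex _ 0 [set p | hermite_interpolates f M p]); exists p.
have [s min_s] := closed_field_poly_normal (mxminpoly M).
have := mxminpoly_monic M; rewrite monicE => /eqP lead1.
rewrite lead1 scale1r in min_s.
have : mxminpoly M %| q - p.
  rewrite min_s; apply: prod_XsubC_dvdp => z; apply: dvdp_XsubCX_derivn => j js.
  have jm : (j < mup z (mxminpoly M))%N by rewrite min_s mu_prod_XsubC.
  by rewrite derivnB hornerD hornerN fp// fq// subrr.
move=> /dvdpP[r /eqP]; rewrite subr_eq => /eqP ->.
by rewrite rmorphD rmorphM /= mx_root_minpoly mulr0 add0r.
Qed.

Context (Gamma : contour R) (Omega : set C).
Hypothesis Omega_open : open Omega.
Hypothesis Gamma_out : contour_support Gamma `<=` ~` Omega.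

(** Integrating the coefficients of the Newton polynomial against g.  Quantifying
    over all linear forms makes the induction on the nodes go through: the step
    replaces g t by g t / (t - a) and psi by psi composed with multiplication by
    X - a.  It also yields the existence of a Hermite interpolant. *)
Lemma newton_interpolant (g : C -> C) (s : seq C) :
  cauchy_density Gamma Omega g -> (forall a, a \in s -> Omega a) ->
  exists p : {poly C}, forall psi : {poly C} -> C,
    (forall c u v, psi (c *: u + v) = c * psi u + psi v) ->
    contour_integrable Gamma (fun t => g t * psi (newton_inv t s)) /\
    psi p = contour_integral Gamma (fun t => g t * psi (newton_inv t s)).
Proof.
elim: s g => [|a s IHs] g gd sO.
  exists 0 => psi psi_lin.
  have psi0 : psi 0 = 0.
    by have := psi_lin (-1) 0 0; rewrite scaler0 add0r mulN1r addNr.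
  split.
    apply: (eq_contour_integrable _ (@contour_integrable0 R Gamma)) => t _.
    by rewrite /= psi0 mulr0.
  rewrite psi0 -[LHS](contour_integral0 Gamma).
  by apply: eq_contour_integral => t _; rewrite mulr0.
have Oa : Omega a by apply: sO; rewrite inE eqxx.
pose ga t := g t * (t - a)^-1.
have gad : cauchy_density Gamma Omega ga.
  exact: cauchy_densityM gd (contour_multiplier_inv Omega_open Gamma_out Oa).
have [|p pE] := IHs ga gad.
  by move=> z zs; apply: sO; rewrite inE zs orbT.
exists (contour_integral Gamma ga *: 1 + ('X - a%:P) * p) => psi psi_lin.
have [|ip pp] := pE (fun q => psi (('X - a%:P) * q)).
  by move=> c u v /=; rewrite mulrDr -scalerAr psi_lin.
have psi0 : psi 0 = 0.
  by have := psi_lin (-1) 0 0; rewrite scaler0 add0r mulN1r addNr.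
have stepE t : psi 1 * ga t + ga t * psi (('X - a%:P) * newton_inv t s) =
    g t * psi (newton_inv t (a :: s)).
  rewrite /= -[_ *: _]addr0 psi_lin psi0 addr0.
  by rewrite -[X in psi (X + _)]scale1r psi_lin mul1r [psi 1 * _]mulrC -mulrDr mulrA.
have i1 := contour_integrableZ (psi 1) (gd _ Oa).
split.
  apply: eq_contour_integrable (contour_integrableD i1 ip) => t _.
  exact: stepE.
rewrite psi_lin pp mulrC -(contour_integralZ _ (gd _ Oa)) -contour_integralD//.
by apply: eq_contour_integral => t _; exact: stepE.
Qed.

Lemma invmx_unit_contour n (A : 'M[C]_n.+1) t :
  spectrum A `<=` Omega -> contour_support Gamma t -> t%:M - A \in unitmx.
Proof.
move=> sA Gt; rewrite unitmxE unitfE -horner_char_polyE -/(root _ _).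
rewrite -eigenvalue_root_char; apply/negP => /sA; exact: Gamma_out.
Qed.

(** The interpolant of [newton_interpolant] is tested against derivatives at the
    eigenvalues, to see that it interpolates F, and against the entries of its
    value at A, to compute F(A). *)
Lemma matfun_cauchy n (A : 'M[C]_n.+1) (g F : C -> C) :
  cauchy_density Gamma Omega g ->
  (forall w, Omega w -> F w = contour_integral Gamma (fun t => g t / (t - w))) ->
  spectrum A `<=` Omega ->
  contour_integrable_mx Gamma (fun t => g t *: invmx (t%:M - A)) /\
  matfun F A = contour_integral_mx Gamma (fun t => g t *: invmx (t%:M - A)).
Proof.
move=> gd FE sA.
have [s min_s] := closed_field_poly_normal (mxminpoly A).
have := mxminpoly_monic A; rewrite monicE => /eqP lead1.
rewrite lead1 scale1r in min_s.
have sO z : z \in s -> Omega z.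
  move=> zs; apply: sA; rewrite /spectrum /= eigenvalue_root_min min_s.
  by rewrite root_prod_XsubC.
have ts t : contour_support Gamma t -> t \notin s.
  by move=> Gt; apply/negP => /sO; exact: Gamma_out.
have [p pE] := newton_interpolant gd sO.
have entryE i j t : t \in contour_support Gamma ->
    g t * horner_mx A (newton_inv t s) i j = (g t *: invmx (t%:M - A)) i j.
  rewrite inE => Gt; rewrite horner_mx_newton_inv ?ts ?mxE//.
  by rewrite -min_s mx_root_minpoly.
have entry_lin i j c (u v : {poly C}) : horner_mx A (c *: u + v) i j =
    c * horner_mx A u i j + horner_mx A v i j.
  by rewrite linearP !mxE.
split=> [i j|].
  have [ip _] := pE _ (entry_lin i j).
  by apply: eq_contour_integrable ip => t Gt; exact: entryE.
rewrite (@matfunE _ _ _ p).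
  apply/matrixP => i j; rewrite mxE; have [_ ->] := pE _ (entry_lin i j).
  by apply: eq_contour_integral => t Gt; exact: entryE.
move=> z k; rewrite min_s mu_prod_XsubC => kz.
have zs : z \in s by rewrite -has_pred1 has_count (leq_ltn_trans _ kz).
have [|ip ->] := pE (fun q => (q^`(k)).[z]).
  by move=> c u v; rewrite derivnD derivnZ hornerD hornerZ.
rewrite (derive1n_cauchy Omega_open Gamma_out k gd FE (sO _ zs)).
rewrite /cauchy_power -contour_integralZ; last first.
  exact (cauchy_integrableX Omega_open Gamma_out k gd (sO _ zs)).
apply: eq_contour_integral => t; rewrite inE => Gt.
by rewrite newton_inv_derivn ?ts// mulrCA.
Qed.

Lemma contour_integrable_mxM p q r s (P : 'M[C]_(p, q)) (Q : 'M[C]_(r, s))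
    (F : C -> 'M[C]_(q, r)) : contour_integrable_mx Gamma F ->
  contour_integrable_mx Gamma (fun t => P *m F t *m Q).
Proof.
move=> iF i j.
apply: (eq_contour_integrable (fun t _ => esym (mulmx3E P (F t) Q i j))).
by do 2 (apply: contour_integrable_sum => ?); exact: contour_integrableZ.
Qed.

Lemma contour_integral_mxM p q r s (P : 'M[C]_(p, q)) (Q : 'M[C]_(r, s))
    (F : C -> 'M[C]_(q, r)) : contour_integrable_mx Gamma F ->
  P *m contour_integral_mx Gamma F *m Q =
  contour_integral_mx Gamma (fun t => P *m F t *m Q).
Proof.
move=> iF; apply/matrixP => i j; rewrite [RHS]mxE mulmx3E.
rewrite (eq_contour_integral (fun t _ => mulmx3E P (F t) Q i j)).
rewrite contour_integral_sum => [|k]; last first.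
  by apply: contour_integrable_sum => ?; exact: contour_integrableZ.
apply: eq_bigr => k _.
rewrite contour_integral_sum => [|l]; last exact: contour_integrableZ.
by apply: eq_bigr => l _; rewrite contour_integralZ// mxE.
Qed.

Lemma contour_integral_mxD p q (F1 F2 : C -> 'M[C]_(p, q)) :
  contour_integrable_mx Gamma F1 -> contour_integrable_mx Gamma F2 ->
  contour_integral_mx Gamma (fun t => F1 t + F2 t) =
  contour_integral_mx Gamma F1 + contour_integral_mx Gamma F2.
Proof.
move=> i1 i2; apply/matrixP => i j; rewrite !mxE -contour_integralD//.
by apply: eq_contour_integral => t _; rewrite mxE.
Qed.

Lemma contour_integral_mxZ p q (c : C) (F : C -> 'M[C]_(p, q)) :
  contour_integrable_mx Gamma F ->
  c *: contour_integral_mx Gamma F =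
  contour_integral_mx Gamma (fun t => c *: F t).
Proof.
move=> iF; apply/matrixP => i j; rewrite !mxE -contour_integralZ//.
by apply: eq_contour_integral => t _; rewrite mxE.
Qed.

Lemma eq_contour_integral_mx p q (F1 F2 : C -> 'M[C]_(p, q)) :
  {in contour_support Gamma, F1 =1 F2} ->
  contour_integral_mx Gamma F1 = contour_integral_mx Gamma F2.
Proof.
move=> F12; apply/matrixP => i j; rewrite !mxE.
by apply: eq_contour_integral => t Gt; rewrite F12.
Qed.

End MatrixFunctions.

(** * The error formula *)

Theorem theorem3p3 (R : realType) (n m : nat)
    (A : 'M[Cx R]_n.+1) (b : 'cV[Cx R]_n.+1)
    (Omega : set (Cx R)) (f : Cx R -> Cx R)
    (Gamma : contour R) (g : Cx R -> Cx R)
    (B : 'M[Cx R]_(n.+1, m.+1)) (H : 'M[Cx R]_m.+1)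
    (bnext : 'cV[Cx R]_n.+1) (hnext beta : Cx R)
    (theta : 'I_m.+1 -> Cx R)
    (Omega_domain : domain Omega)
    (specA : spectrum A `<=` Omega)
    (f_analytic : analytic_on f (closure Omega))
    (Gamma_out : contour_support Gamma `<=` ~` Omega)
    (f_integrable : forall z, Omega z ->
       contour_integrable Gamma (fun t => g t / (t - z)))
    (f_repr : forall z, Omega z ->
       f z = contour_integral Gamma (fun t => g t / (t - z)))
    (krylov_dim : forall j, (1 <= j <= m.+1)%N -> \dim (krylov A b j) = j)
    (arnoldi : arnoldi_like A b B H bnext hnext beta)
    (theta_eigen : char_poly H = \prod_(j < m.+1) ('X - (theta j)%:P))
    (theta_Omega : forall j, Omega (theta j))
    (int_exists : contour_integrable_mx Gamma
       (fun t => (g t / nodal theta t) *: invmx (t%:M - A))) :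
  matfun f A *m b - arnoldi_approx f B H beta =
    (subdiag_prod H hnext * beta) *:
      (contour_integral_mx Gamma
         (fun t => (g t / nodal theta t) *: invmx (t%:M - A)) *m bnext)
  /\
  matfun f A *m b - arnoldi_approx f B H beta =
    matfun (err_fun Gamma g H hnext beta theta) A *m bnext.
Proof.
have [_ Omega_open _] := Omega_domain.
have [AB _ hess bE] := arnoldi.
set c := subdiag_prod H hnext * beta.
have nodalE t : (char_poly H).[t] = nodal theta t.
  by rewrite theta_eigen horner_prod; apply: eq_bigr => j _; rewrite hornerXsubC.
have specH : spectrum H `<=` Omega.
  move=> z; rewrite /spectrum /= eigenvalue_root_char /root nodalE.
  by move=> /prodf_eq0[j _]; rewrite subr_eq0 => /eqP ->.
have [iA fA] := matfun_cauchy Omega_open Gamma_out f_integrable f_repr specA.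
have [iH fH] := matfun_cauchy Omega_open Gamma_out f_integrable f_repr specH.
(* The kernels 1 / (t - theta_j) are bounded on the contour, so dividing by the
   nodal polynomial preserves the property of having a Cauchy integral. *)
have ged : cauchy_density Gamma Omega (fun t => g t / nodal theta t).
  apply: cauchy_densityM f_integrable _.
  exact: (contour_multiplier_prod Omega_open Gamma_out).
pose Gerr t := (g t / nodal theta t) *: invmx (t%:M - A).
have scalarE (v : 'cV[Cx R]_n.+1) : c%:M *m v = c *: v by rewrite mul_scalar_mx.
have err_integral : matfun f A *m b - arnoldi_approx f B H beta =
    c *: (contour_integral_mx Gamma Gerr *m bnext).
  have eA := contour_integral_mxM 1%:M b iA.
  have eH := contour_integral_mxM (beta *: B) (delta_mx ord0 ord0) iH.
  have eK := contour_integral_mxM c%:M bnext int_exists.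
  rewrite mul1mx -fA in eA; rewrite -fH in eH.
  rewrite -scalarE mulmxA eK eA.
  have -> : arnoldi_approx f B H beta =
      (beta *: B) *m matfun f H *m delta_mx ord0 ord0.
    by rewrite /arnoldi_approx !scalemxAl.
  rewrite eH; apply/eqP; rewrite subr_eq; apply/eqP.
  rewrite -(contour_integral_mxD (contour_integrable_mxM c%:M bnext int_exists)
    (contour_integrable_mxM (beta *: B) (delta_mx ord0 ord0) iH)).
  apply: eq_contour_integral_mx => t; rewrite inE => Gt.
  have tA := invmx_unit_contour Gamma_out specA Gt.
  have tH := invmx_unit_contour Gamma_out specH Gt.
  rewrite (arnoldi_weighted_resolvent (g t) AB hess bE tA tH).
  by rewrite nodalE.
split=> //; rewrite err_integral.
have cged : cauchy_density Gamma Omega (fun t => c * (g t / nodal theta t)).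
  move=> z Oz; apply: eq_contour_integrable (contour_integrableZ c (ged z Oz)).
  by move=> t _; rewrite mulrA.
have errE z : Omega z -> err_fun Gamma g H hnext beta theta z =
    contour_integral Gamma (fun t => c * (g t / nodal theta t) / (t - z)).
  move=> Oz; rewrite /err_fun -(contour_integralZ _ (ged z Oz)).
  by apply: eq_contour_integral => t _; rewrite mulrA.
have [_ ->] := matfun_cauchy Omega_open Gamma_out cged errE specA.
rewrite scalemxAl (contour_integral_mxZ c int_exists); congr (_ *m _).
by apply: eq_contour_integral_mx => t _; exact: scalerA.
Qed.
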